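(* Let $a,b\in\mathbb{C}$ be such that $\{a^kb^l : k,l\in\mathbb{N}\}$ is dense in $\mathbb{C}$. Let $n\geq 2$ be an integer and consider the diagonal $n\times n$ matrices $A=\mathrm{diag}(a_1,a_2,\ldots,a_n)$ and $B=\mathrm{diag}(b_1,b_2,\ldots,b_n)$, where $a_1=a$, $b_1=b$, and $a_j,b_j\in\mathbb{C}$ with $|a_j|>1$ and $|b_j|>1$ for $j=2,\ldots,n$. Then $(A,B)$ is a locally hypercyclic pair on $\mathbb{C}^n$ which is not hypercyclic. In particular, \[\{z\in\mathbb{C}^n : J_{(A,B)}(z)=\mathbb{C}^n\}=\{(z_1,0,\ldots,0)^t\in\mathbb{C}^n : z_1\in\mathbb{C}\}.\]
   Context: Here $\mathbb{N}=\{1,2,3,\ldots\}$ and $u^t$ denotes the transpose of $u$. Let $(T_1,T_2)$ be a pair of commuting complex $n\times n$ matrices, regarded as linear operators on $X=\mathbb{C}^n$. The pair is hypercyclic if there exists $x\in X$ such that $\{T_1^{k_1}T_2^{k_2}x : k_1,k_2\in\mathbb{N}\cup\{0\}\}$ is dense in $X$. For $x\in X$, the extended limit set $J_{(T_1,T_2)}(x)$ is the set of all $y\in X$ for which there exist a sequence of vectors $x_m\to x$ in $X$ and sequences of non-negative integers $\{k_m^{(1)}\}_{m\in\mathbb{N}}$, $\{k_m^{(2)}\}_{m\in\mathbb{N}}$ with $k_m^{(1)}+k_m^{(2)}\to+\infty$ such that $T_1^{k_m^{(1)}}T_2^{k_m^{(2)}}x_m\to y$. The pair is locally hypercyclic if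 there exists $x\in X\setminus\{0\}$ with $J_{(T_1,T_2)}(x)=X$. *)

(* Defs.v *)
From HB Require Import structures.
From mathcomp Require Import all_boot all_order all_algebra.
From mathcomp Require Export complex.
From mathcomp Require Import all_classical all_reals all_analysis.
Set Implicit Arguments.
Unset Strict Implicit.
Unset Printing Implicit Defensive.
Import Order.TTheory GRing.Theory Num.Theory.
Import numFieldNormedType.Exports.
Local Open Scope classical_set_scope.
Local Open Scope ring_scope.
Local Open Scope complex_scope.

(* The usual topology of the complex numbers, given by the modulus. The library
   provides it for an abstract [numFieldType] only, not for the type [R[i]]; the
   matrix types over [R[i]] then inherit the product topology. *)
HB.instance Definition _ (R : realType) :=
  PseudoPointedMetric.copy R[i] R[i]^o.
HB.instance Definition _ (R : realType) := NormedModule.copy R[i] R[i]^o.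

(* The definitions below make sense for arbitrary matrices; they are meant for
   commuting ones. *)

Definition hypercyclic (R : realType) (n : nat) (T1 T2 : 'M[R[i]]_n) : Prop :=
  exists x : 'cV[R[i]]_n,
    dense [set y | exists k1 k2 : nat, y = (T1 ^+ k1 *m T2 ^+ k2) *m x].

Definition extended_limit_set (R : realType) (n : nat) (T1 T2 : 'M[R[i]]_n)
    (x : 'cV[R[i]]_n) : set 'cV[R[i]]_n :=
  [set y | exists (u : nat -> 'cV[R[i]]_n) (k1 k2 : nat -> nat),
    [/\ u m @[m --> \oo] --> x,
        (k1 m + k2 m)%N @[m --> \oo] --> \oo &
        (T1 ^+ k1 m *m T2 ^+ k2 m) *m u m @[m --> \oo] --> y]].

Definition locally_hypercyclic (R : realType) (n : nat) (T1 T2 : 'M[R[i]]_n) :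
    Prop :=
  exists x : 'cV[R[i]]_n, x <> 0 /\ extended_limit_set T1 T2 x = setT.

(* Main.v *)
Require Import Defs.
From mathcomp Require Import all_boot all_order all_algebra.
From mathcomp Require Import all_classical all_reals all_analysis.
Set Implicit Arguments.
Unset Strict Implicit.
Unset Printing Implicit Defensive.
Import Order.TTheory GRing.Theory Num.Theory.
Import numFieldNormedType.Exports.
Local Open Scope classical_set_scope.
Local Open Scope ring_scope.
Local Open Scope complex_scope.

(** A diagonal pair acts on each coordinate separately, multiplying the [j]-th one
    by [alpha_j ^+ k * beta_j ^+ l]. The first coordinate and the remaining ones
    play opposite roles.

    On a coordinate with [j > 0] both multipliers have modulus above one, so moduli
    never decrease. Hence a perturbed orbit starting near [z] with [z_j] nonzero
    cannot tend to [0], and [0] is missing from the extended limit set of [z]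
    ([extended_limit_set_noncontracting_coord]). The same growth prevents the [j]-th
    coordinates of a single orbit from being dense, so no vector is hypercyclic
    ([noncontracting_coord_not_hypercyclic]).

    Conversely, let [z] vanish on all coordinates with [j > 0], and let [y] be any
    target ([extended_limit_set_axis]). Move [z_0] slightly to a nonzero [w]. Density
    of the numbers [a ^+ k * b ^+ l], which persists when [k + l] is required to be
    large ([dense_monomials_large]), gives exponents taking [w] close to [y_0]. On
    the other coordinates start from [y_j / (alpha_j ^+ k * beta_j ^+ l)], which is
    mapped exactly onto [y_j] and is close to [0] because the denominators are
    unbounded as [k + l] grows ([monomial_eventually_gt]). *)

(** * Growth of products of powers *)

Lemma complex_lt_natr (R : realType) (x : R[i]) :
  0 <= x -> exists n : nat, x < n%:R.
Proof.
case: x => r s; rewrite lecE /= => /andP[/eqP -> _].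
exists (Num.bound `|r|).
have <- : (Num.bound `|r|)%:R%:C = (Num.bound `|r|)%:R :> R[i] by exact: rmorph_nat.
rewrite ltcR.
by rewrite (le_lt_trans (ler_norm r))// archi_boundP.
Qed.

(** A weak form of the Bernoulli inequality, which makes the powers unbounded. *)
Lemma exprn_ge_linear (K : numDomainType) (g : K) (k : nat) :
  1 <= g -> (g - 1) *+ k <= g ^+ k.
Proof.
move=> g1; elim: k => [|k IHk]; first by rewrite mulr0n expr0 ler01.
have gk1 : 1 <= g ^+ k by rewrite exprn_ege1.
rewrite mulrSr exprSr -[X in _ <= _ * X](subrK 1) mulrDr mulr1 [leRHS]addrC.
by rewrite lerD// ler_peMl// subr_ge0.
Qed.

Lemma expr_eventually_gt (R : realType) (g x : R[i]) : 1 < g -> 0 <= x ->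
  exists N : nat, forall k, (N <= k)%N -> x < g ^+ k.
Proof.
move=> g1 x0; have d0 : 0 < g - 1 by rewrite subr_gt0.
have [|N xN] := @complex_lt_natr R (x / (g - 1)).
  by rewrite divr_ge0// ltW.
exists N => k Nk; apply: lt_le_trans (exprn_ge_linear k (ltW g1)).
rewrite ltr_pdivrMr// mulr_natl in xN.
by rewrite (lt_le_trans xN)// ler_wpMn2l// ltW.
Qed.

(** If [k + l] is large then [k] or [l] is, and the other factor has modulus at
    least one. *)
Lemma monomial_eventually_gt (R : realType) (p q x : R[i]) :
  1 < `|p| -> 1 < `|q| -> 0 <= x ->
  \forall N \near \oo, forall k l, (N <= k + l)%N -> x < `|p ^+ k * q ^+ l|.
Proof.
move=> p1 q1 x0.
have [N1 pN1] := expr_eventually_gt p1 x0.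
have [N2 qN2] := expr_eventually_gt q1 x0.
exists (N1 + N2)%N => // N /= N12 k l Nkl; rewrite normrM !normrX.
have pk1 : 1 <= `|p| ^+ k by rewrite exprn_ege1// ltW.
have ql1 : 1 <= `|q| ^+ l by rewrite exprn_ege1// ltW.
have [N1k|kN1] := leqP N1 k.
  apply: lt_le_trans (pN1 _ N1k) _.
  by rewrite ler_peMr// (le_trans ler01).
have N2l : (N2 <= l)%N.
  rewrite -(leq_add2l k) (leq_trans _ Nkl)// (leq_trans _ N12)//.
  by rewrite leq_add2r ltnW.
apply: lt_le_trans (qN2 _ N2l) _.
by rewrite ler_peMl// (le_trans ler01).
Qed.

(** * Density with large exponents *)

(** Multiplication by [a ^+ N] is a homeomorphism of the plane, so approximating
    [w / a ^+ N] instead of [w] buys an exponent of at least [N]. The positive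
    exponents in the dense set give [a != 0], since [a = 0] would reduce that set to
    the origin. *)
Lemma dense_monomials_large (R : realType) (a b : R[i]) :
  dense [set z : R[i] | exists k l : nat,
      [/\ (0 < k)%N, (0 < l)%N & z = a ^+ k * b ^+ l]] ->
  forall (N : nat) (w e : R[i]), 0 < e ->
  exists k l : nat, (N <= k + l)%N /\ `|w - a ^+ k * b ^+ l| < e.
Proof.
move=> dab N w e e0.
have approx v d : 0 < d ->
    exists k l : nat, (0 < k)%N /\ `|v - a ^+ k * b ^+ l| < d.
  move=> d0; have [||z [vz [k [l [k0 _ zE]]]]] := dab (ball v d).
  - by exists v; exact: ballxx.
  - exact: ball_open.
  by move: vz; rewrite zE -ball_normE => vkl; exists k, l.
have a0 : a != 0.
  apply/eqP => a0; have [k [l [k0]]] := approx 1 1 ltr01.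
  by rewrite a0 expr0n eqn0Ngt k0 mul0r subr0 normr1 ltxx.
have aN0 : a ^+ N != 0 by rewrite expf_neq0.
have aN_gt0 : 0 < `|a ^+ N| by rewrite normr_gt0.
have [k [l [_ wkl]]] := approx (w / a ^+ N) (e / `|a ^+ N|) (divr_gt0 e0 aN_gt0).
exists (N + k)%N, l; split; first by rewrite -addnA leq_addr.
rewrite ltr_pdivlMr// -normrM mulrBl divfK// in wkl.
by rewrite exprD -mulrA [_ * (_ * _)]mulrC.
Qed.

(** * Orbits and extended limit sets of diagonal pairs *)

Lemma expr_diag_mx (K : pzSemiRingType) (n : nat) (d : 'rV[K]_n) (k : nat) :
  diag_mx d ^+ k = diag_mx (\row_j d 0 j ^+ k).
Proof.
elim: k => [|k IHk].
  by apply/matrixP => i j; rewrite expr0 !mxE.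
rewrite exprS IHk [_ * _]mulmx_diag; congr diag_mx.
by apply/rowP => j; rewrite !mxE exprS.
Qed.

Lemma diag_pair_orbitE (K : pzSemiRingType) (n : nat) (alpha beta : 'rV[K]_n)
    (k l : nat) (x : 'cV[K]_n) (i : 'I_n) (j : 'I_1) :
  (diag_mx alpha ^+ k *m diag_mx beta ^+ l *m x) i j =
  alpha 0 i ^+ k * beta 0 i ^+ l * x i j.
Proof. by rewrite !expr_diag_mx mulmx_diag mul_diag_mx !mxE. Qed.

(** Choosing one approximation for each tolerance [1 / (m + 1)] and exponent
    bound [m] produces the sequences required by the extended limit set. *)
Lemma extended_limit_set_approx (R : realType) (n : nat) (T1 T2 : 'M[R[i]]_n)
    (x y : 'cV[R[i]]_n) :
  (forall (e : R[i]) (N : nat), 0 < e -> exists (u : 'cV[R[i]]_n) k l, [/\ (N <= k + l)%N,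
     forall i, `|x i 0 - u i 0| < e &
     forall i, `|y i 0 - (T1 ^+ k *m T2 ^+ l *m u) i 0| < e]) ->
  extended_limit_set T1 T2 x y.
Proof.
move=> H.
pose eps (m : nat) : R[i] := m.+1%:R^-1.
have eps0 m : 0 < eps m by rewrite invr_gt0 ltr0n.
have /choice[f fP] (m : nat) : exists p : 'cV[R[i]]_n * (nat * nat),
    [/\ (m <= p.2.1 + p.2.2)%N, forall i, `|x i 0 - p.1 i 0| < eps m &
     forall i, `|y i 0 - (T1 ^+ p.2.1 *m T2 ^+ p.2.2 *m p.1) i 0| < eps m].
  by have [u [k [l ukl]]] := H (eps m) m (eps0 m); exists (u, (k, l)).
have cvg_col (v : 'cV[R[i]]_n) (u : nat -> 'cV[R[i]]_n) :
    (forall m i, `|v i 0 - u m i 0| < eps m) -> u m @[m --> \oo] --> v.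
  move=> uv; apply/cvg_ballP => e e0.
  have [|N eN] := @complex_lt_natr R e^-1; first by rewrite invr_ge0 ltW.
  exists N => // m /= Nm; split=> // i j; rewrite (ord1 j) -ball_normE /=.
  apply: lt_le_trans (uv m i) _.
  rewrite /eps -[leRHS]invrK lef_pV2 ?posrE ?ltr0n ?invr_gt0//.
  by rewrite (le_trans (ltW eN))// ler_nat leqW.
exists (fun m => (f m).1), (fun m => (f m).2.1), (fun m => (f m).2.2); split.
- by apply: cvg_col => m i; have [_ + _] := fP m; exact.
- apply/cvgnyPge => N; exists N => // m /= Nm.
  by have [mkl _ _] := fP m; exact: leq_trans mkl.
- by apply: cvg_col => m i; have [_ _] := fP m; exact.
Qed.

(** If neither map contracts the [i]-th coordinate and [z i 0] is nonzero, orbit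
    segments starting near [z] stay away from zero in that coordinate, so their
    end points cannot converge to the origin. *)
Lemma extended_limit_set_noncontracting_coord (R : realType) (n : nat)
    (alpha beta : 'rV[R[i]]_n) (z : 'cV[R[i]]_n) (i : 'I_n) :
  1 <= `|alpha 0 i| -> 1 <= `|beta 0 i| ->
  extended_limit_set (diag_mx alpha) (diag_mx beta) z 0 -> z i 0 = 0.
Proof.
move=> a1 b1 [u [k1 [k2 [uz _ u0]]]]; apply: contrapT => /eqP zi0.
have e0 : 0 < `|z i 0| / 2 by rewrite divr_gt0 ?normr_gt0// ltr0n.
have /cvg_ballP/(_ _ e0) Fz := uz; have /cvg_ballP/(_ _ e0) F0 := u0.
near \oo => m.
have [_ /(_ i 0)] : ball z (`|z i 0| / 2) (u m) by near: m.
rewrite -ball_normE /= => zu.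
have : ball (0 : 'cV[R[i]]_n) (`|z i 0| / 2)
    (diag_mx alpha ^+ k1 m *m diag_mx beta ^+ k2 m *m u m) by near: m.
case=> _ /(_ i 0); rewrite -ball_normE /= mxE sub0r normrN diag_pair_orbitE => ue.
(* Non-contraction bounds the i-th coordinate of u m by that of its image, which is
   below half of that of z; but u m is closer to z than the other half. *)
have : `|z i 0| < `|z i 0|; last by rewrite ltxx.
have -> : `|z i 0| = `|z i 0 - u m i 0 + u m i 0| by rewrite subrK.
apply: le_lt_trans (ler_normD _ _) _.
rewrite subrK [ltRHS](splitr `|z i 0|) ltrD//.
apply: le_lt_trans ue; rewrite !normrM !normrX ler_peMl//.
by rewrite -[leLHS]mulr1 ler_pM// exprn_ege1.
Unshelve. all: by end_near. Qed.

(** Keep the first coordinate away from zero and drive it to its target by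
    density; the other coordinates start at the target divided by the expansion
    factor, hence arbitrarily close to zero. *)
Lemma extended_limit_set_axis (R : realType) (a b : R[i]) :
  dense [set z : R[i] | exists k l : nat,
      [/\ (0 < k)%N, (0 < l)%N & z = a ^+ k * b ^+ l]] ->
  forall (n : nat) (alpha beta : 'rV[R[i]]_n), (0 < n)%N ->
  (forall j : 'I_n, j = 0%N :> nat -> alpha 0 j = a) ->
  (forall j : 'I_n, j = 0%N :> nat -> beta 0 j = b) ->
  (forall j : 'I_n, (0 < j)%N -> 1 < `|alpha 0 j|) ->
  (forall j : 'I_n, (0 < j)%N -> 1 < `|beta 0 j|) ->
  forall z : 'cV[R[i]]_n, (forall j : 'I_n, (0 < j)%N -> z j 0 = 0) ->
  extended_limit_set (diag_mx alpha) (diag_mx beta) z = setT.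
Proof.
move=> dab n alpha beta n_gt0 alpha1 beta1 alpha_gt1 beta_gt1 z z0.
rewrite -subTset => y _; apply: extended_limit_set_approx => e N e0.
have near_nonzero x : exists2 v : R[i], v != 0 & `|x - v| < e.
  have [->|x0] := eqVneq x 0; last by exists x; rewrite // subrr normr0.
  exists (e / 2); first by rewrite gt_eqF// divr_gt0// ltr0n.
  rewrite sub0r normrN gtr0_norm ?divr_gt0 ?ltr0n//.
  by rewrite ltr_pdivrMr ?ltr0n// ltr_pMr// ltr1n.
have [M _ MP] : \forall M \near \oo, forall j : 'I_n, forall k l,
    (0 < j)%N -> (M <= k + l)%N ->
    `|y j 0| / e < `|alpha 0 j ^+ k * beta 0 j ^+ l|.
  apply: filter_forall => j; case: (ltnP 0 j) => [j0|j0].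
    have ye0 : 0 <= `|y j 0| / e by rewrite divr_ge0// ltW.
    near=> M => k l _; move: k l; near: M.
    exact: (monomial_eventually_gt (alpha_gt1 j j0) (beta_gt1 j j0) ye0).
  by exists 0%N.
pose j0 := Ordinal n_gt0.
have [w w0 zw] := near_nonzero (z j0 0).
have w_gt0 : 0 < `|w| by rewrite normr_gt0.
have [k [l [MNkl ykl]]] :=
  dense_monomials_large dab (maxn M N) (y j0 0 / w) (divr_gt0 e0 w_gt0).
move: MNkl; rewrite geq_max => /andP[Mkl Nkl].
have large (j : 'I_n) : (0 < j)%N ->
    `|y j 0| / e < `|alpha 0 j ^+ k * beta 0 j ^+ l|.
  by move=> j_gt0; exact: (MP M (leqnn M)).
have factor0 (j : 'I_n) : (0 < j)%N -> 0 < `|alpha 0 j ^+ k * beta 0 j ^+ l|.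
  by move=> j_gt0; rewrite (le_lt_trans _ (large j j_gt0))// divr_ge0// ltW.
exists (\col_j (if j == 0%N :> nat then w
                else y j 0 / (alpha 0 j ^+ k * beta 0 j ^+ l))), k, l.
split=> // j.
  rewrite mxE; case: eqP => [jE|/eqP]; first by rewrite (_ : j = j0)//; exact: val_inj.
  rewrite -lt0n => j_gt0; rewrite z0// sub0r normrN normf_div.
  rewrite ltr_pdivrMr ?factor0// mulrC -ltr_pdivrMr//; exact: large.
rewrite diag_pair_orbitE mxE; case: eqP => [jE|/eqP].
  have -> : j = j0 by exact: val_inj.
  rewrite alpha1// beta1// -[y j0 0](divfK w0) -mulrBl normrM.
  by rewrite -ltr_pdivlMr.
rewrite -lt0n => j_gt0; rewrite mulrC divfK ?subrr ?normr0//.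
by rewrite -normr_gt0 factor0.
Unshelve. all: by end_near. Qed.

(** Along an orbit a coordinate that neither map contracts avoids, if it starts
    at a nonzero value, the disc of that modulus around zero; if it starts at
    zero it stays there. Either way its values are not dense in the plane. *)
Lemma noncontracting_coord_not_hypercyclic (R : realType) (n : nat)
    (alpha beta : 'rV[R[i]]_n) (i : 'I_n) :
  1 <= `|alpha 0 i| -> 1 <= `|beta 0 i| ->
  ~ hypercyclic (diag_mx alpha) (diag_mx beta).
Proof.
move=> a1 b1 [x dx].
have approx c e : 0 < e ->
    exists k l, `|c - alpha 0 i ^+ k * beta 0 i ^+ l * x i 0| < e.
  move=> e0; pose y : 'cV[R[i]]_n := const_mx c.
  have [||y' [yy' [k [l y'E]]]] := dx (ball y e)°.
  - by exists y; exact: nbhsx_ballx.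
  - exact: open_interior.
  move: yy'; rewrite y'E => /interior_subset[_ /(_ i 0)].
  by rewrite -ball_normE /= mxE diag_pair_orbitE => ?; exists k, l.
have [xi0|xi0] := eqVneq (x i 0) 0.
  have [k [l]] := approx 1 1 ltr01.
  by rewrite xi0 mulr0 subr0 normr1 ltxx.
have xi_gt0 : 0 < `|x i 0| by rewrite normr_gt0.
have [k [l]] := approx 0 _ xi_gt0; rewrite sub0r normrN !normrM !normrX.
rewrite gtr_pMl// => /lt_geF/negP; apply.
by rewrite -[leLHS]mulr1 ler_pM// exprn_ege1.
Qed.


(* The indices 1, ..., n are represented by 0, ..., n - 1 in 'I_n. *)
Theorem theorem3p4 (R : realType) (a b : R[i])
  (dense_ab : dense [set z : R[i] | exists k l : nat,
      [/\ (0 < k)%N, (0 < l)%N & z = a ^+ k * b ^+ l]])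
  (n : nat) (n_ge2 : (2 <= n)%N) (alpha beta : 'rV[R[i]]_n)
  (alpha1 : forall j : 'I_n, j = 0%N :> nat -> alpha 0 j = a)
  (beta1 : forall j : 'I_n, j = 0%N :> nat -> beta 0 j = b)
  (alpha_gt1 : forall j : 'I_n, (0 < j)%N -> 1 < `|alpha 0 j|)
  (beta_gt1 : forall j : 'I_n, (0 < j)%N -> 1 < `|beta 0 j|) :
  let A := diag_mx alpha in
  let B := diag_mx beta in
  [/\ locally_hypercyclic A B,
      ~ hypercyclic A B &
      [set z : 'cV[R[i]]_n | extended_limit_set A B z = setT] =
      [set z : 'cV[R[i]]_n | exists z1 : R[i],
          z = \col_(j < n) (if j == 0%N :> nat then z1 else 0)]].
Proof.
have n_gt0 : (0 < n)%N by exact: leq_trans n_ge2.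
move=> A B.
have axisP (z : 'cV[R[i]]_n) :
    extended_limit_set A B z = setT <-> forall j : 'I_n, (0 < j)%N -> z j 0 = 0.
  split=> [zT j j0|]; last exact: (extended_limit_set_axis dense_ab n_gt0).
  have : extended_limit_set A B z 0 by rewrite zT.
  by apply: extended_limit_set_noncontracting_coord; rewrite ltW ?alpha_gt1 ?beta_gt1.
split.
- exists (\col_(j < n) (j == 0%N :> nat)%:R); split.
    move=> /colP/(_ (Ordinal n_gt0)); rewrite !mxE eqxx => /eqP.
    by rewrite oner_eq0.
  by apply/axisP => j j0; rewrite mxE gtn_eqF.
- apply: (@noncontracting_coord_not_hypercyclic _ _ _ _ (Ordinal n_ge2)).
    by rewrite ltW ?alpha_gt1.
  by rewrite ltW ?beta_gt1.
- apply/seteqP; split=> z /=.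
    move=> /axisP z0; exists (z (Ordinal n_gt0) 0); apply/colP => j; rewrite mxE.
    case: eqP => [j0|/eqP]; last by rewrite -lt0n => /z0.
    by congr (z _ _); exact: val_inj.
  by move=> [z1 ->]; apply/axisP => j j0; rewrite mxE gtn_eqF.
Qed.
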